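(* Let $(N_{II}(t))_{t\in\mathbb{N}_0}$ be a recurrent (type II) discrete-time renewal process, and let $\Delta T$ be a possibly defective stopping time with values in $\mathbb{N}\cup\{\infty\}$, independent of $N_{II}$, with $\psi_S(r)=\mathbb{P}[\Delta T=r]$ for $r\in\mathbb{N}$ and $\sum_{r=1}^{\infty}\psi_S(r)=\mathcal{Q}_S\in(0,1]$. Let $$M(t)=\Theta(\Delta T-1-t)\,N_{II}(t)+\Theta(t-\Delta T)\,N_{II}(\Delta T),\qquad t\in\mathbb{N}_0 .$$ Then for all $m,t\in\mathbb{N}_0$, $$\mathbb{P}[M(t)=m]=(1-\mathcal{Q}_S)\,\Phi_{II}^{(m)}(t)+\sum_{r=1}^{\infty}\psi_S(r)\Big(\Phi_{II}^{(m)}(t)\,\Theta(r-t-1)+\Phi_{II}^{(m)}(r)\,\Theta(t-r)\Big),$$ where $\Phi_{II}^{(m)}(r)=\mathbb{P}[N_{II}(r)=m]$.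
   Context: $\mathbb{N}=\{1,2,\dots\}$, $\mathbb{N}_0=\{0,1,2,\dots\}$. $\Theta$ is the discrete Heaviside function: $\Theta(r)=1$ for $r\ge 0$ and $\Theta(r)=0$ for $r<0$. A recurrent (type II) discrete-time renewal process is $N_{II}(t)=\max\{n\ge 0: J_n\le t\}$, where $J_0=0$, $J_n=\sum_{j=1}^n\Delta t_j$, and the waiting times $\Delta t_j$ are IID, $\mathbb{N}$-valued and almost surely finite. A defective $\Delta T$ has missing probability mass $1-\mathcal{Q}_S=\mathbb{P}[\Delta T=\infty]$ placed at infinity. On $\{\Delta T=\infty\}$ the process is never stopped: $M(t)=N_{II}(t)$ for all $t$ (i.e. $M(t)=N_{II}(t)$ for $t<\Delta T$ and $M(t)=N_{II}(\Delta T)$ for $t\ge \Delta T$). *)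

(* Defs.v *)
From HB Require Import structures.
From mathcomp Require Export all_boot all_order all_algebra.
From mathcomp Require Export all_classical all_reals all_analysis
  measurable_realfun.

Set Implicit Arguments.
Unset Strict Implicit.
Unset Printing Implicit Defensive.

Import Order.TTheory GRing.Theory Num.Theory.
Import numFieldNormedType.Exports.

Local Open Scope classical_set_scope.
Local Open Scope ring_scope.
Local Open Scope ereal_scope.

(* Discrete Heaviside function. It is taken on \bar R because its argument
   involves a random time that may be +oo. *)
Definition Theta (R : realType) (x : \bar R) : nat := (0 <= x)%E.

(* Elements of {1, 2, ...} `|` {+oo}, seen in \bar R. *)
Definition pos_nat_or_infty (R : realType) (x : \bar R) : Prop :=
  x = +oo \/ exists2 k : nat, (0 < k)%N & x = k%:R%:E.

(* The maximum of A, or 0 if A has no maximum. *)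
Definition max_nat (A : set nat) : nat := xget 0%N (A `&` ubound A).

Section renewal.
Context (d : measure_display) (T : measurableType d) (R : realType)
  (P : probability T R).
Implicit Types dt : nat -> T -> \bar R.

Definition mutually_independent dt : Prop :=
  forall (s : seq nat) (B : nat -> set (\bar R)), uniq s ->
    (forall j, measurable (B j)) ->
    P (\bigcap_(j in [set` s]) (dt j @^-1` B j)) =
    \prod_(j <- s) P (dt j @^-1` B j).

Definition identically_distributed dt : Prop :=
  forall (i j : nat) (B : set (\bar R)), measurable B ->
    P (dt i @^-1` B) = P (dt j @^-1` B).

(* dt j is the (j+1)-st waiting time. *)
Definition recurrent_waiting_times dt : Prop :=
  [/\ forall j w, pos_nat_or_infty (dt j w),
      forall j, P [set w | dt j w = +oo] = 0,
      mutually_independent dt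
    & identically_distributed dt].

Definition arrival dt (n : nat) (w : T) : \bar R := \sum_(j < n) dt j w.

Definition renewal dt (t : nat) (w : T) : nat :=
  max_nat [set n | arrival dt n w <= t%:R%:E].

Definition sigma_rv (X : T -> \bar R) : set (set T) :=
  preimage_set_system setT X measurable.

Definition sigma_process (N : nat -> T -> nat) : set (set T) :=
  <<s \bigcup_t preimage_set_system setT (N t) measurable >>.

Definition independent_of_process (X : T -> \bar R) (N : nat -> T -> nat) :=
  forall A B : set T, sigma_rv X A -> sigma_process N B ->
    P (A `&` B) = P A * P B.

(* On [DT w = +oo] the second summand is 0, so the value
   Num.truncn (fine +oo) = 0 of the time index is immaterial there. *)
Definition stopped (DT : T -> \bar R) (N : nat -> T -> nat)
    (t : nat) (w : T) : nat :=
  (Theta (DT w - 1 - t%:R%:E) * N t w +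
   Theta (t%:R%:E - DT w) * N (Num.truncn (fine (DT w))) w)%N.

Definition state_prob (N : nat -> T -> nat) (m t : nat) : \bar R :=
  P [set w | N t w = m].

Definition time_prob (DT : T -> \bar R) (r : nat) : \bar R :=
  P [set w | DT w = r%:R%:E].

Lemma arrival_ge dt w : (forall j, pos_nat_or_infty (dt j w)) ->
  forall n, n%:R%:E <= arrival dt n w.
Proof.
move=> h; elim=> [|n IHn]; rewrite /arrival ?big_ord0// big_ord_recr/=.
rewrite -natr1 EFinD; apply: leeD => //.
by case: (h n) => [->|[k k0 ->]]; rewrite ?leey// lee_fin ler1n.
Qed.

Lemma renewal_max dt t w : (forall j, pos_nat_or_infty (dt j w)) ->
  arrival dt (renewal dt t w) w <= t%:R%:E /\
  forall n, arrival dt n w <= t%:R%:E -> (n <= renewal dt t w)%N.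
Proof.
move=> h; pose p n := arrival dt n w <= t%:R%:E.
have p0 : exists n, p n.
  by exists 0%N; rewrite /p /arrival big_ord0 lee_fin.
have pt n : p n -> (n <= t)%N.
  by move=> /(le_trans (arrival_ge h n)); rewrite lee_fin ler_nat.
rewrite /renewal /max_nat; case: xgetP => [n _ [An ub]|].
  by split=> // k Ak; have := ub k Ak; rewrite leEnat.
case: (ex_maxnP p0 pt) => n pn nmax /(_ n) []; split=> [//|k pk].
by rewrite leEnat; exact: nmax.
Qed.

End renewal.

(* Main.v *)
Require Import Defs.

(* Condition on the value of DT. The countably many events [DT = +oo] and
   [DT = r], r >= 1, partition the sample space; on the first M(t) = N(t), and
   on [DT = r] M(t) = N(min(t, r)). Independence factors each piece, and the
   same decomposition of the whole space gives P[DT = +oo] = 1 - QS. *)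

Set Implicit Arguments.
Unset Strict Implicit.
Unset Printing Implicit Defensive.

Import Order.TTheory GRing.Theory Num.Theory.
Import numFieldNormedType.Exports.

Local Open Scope classical_set_scope.
Local Open Scope ring_scope.
Local Open Scope ereal_scope.

Section total_probability.
Context (d : measure_display) (T : measurableType d) (R : realType)
  (P : probability T R).

(** Countable additivity over the values of [X]. Measurability is asked of the pieces only, and that
    of [A] follows from theirs, so the events of the stopped process can be treated piece by
    piece. *)
Lemma total_probability_pos_nat_or_infty (X : T -> \bar R) (A : set T) :
  (forall w, pos_nat_or_infty (X w)) ->
  measurable ([set w | X w = +oo] `&` A) ->
  (forall r, (0 < r)%N -> measurable ([set w | X w = r%:R%:E] `&` A)) ->
  P A = P ([set w | X w = +oo] `&` A) +
        \sum_(1 <= r <oo) P ([set w | X w = r%:R%:E] `&` A).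
Proof.
(* Finite values start at 1, so index 0 is free to encode [+oo]. *)
move=> hX mAoo mA; pose c r : \bar R := if r is 0%N then +oo else r%:R%:E.
pose F r := [set w | X w = c r] `&` A.
have cI : injective c.
  case=> [|i] [|j]// cij; apply/eqP.
  by rewrite -(eqr_nat R); apply/eqP; case: cij.
have AF : A = \bigcup_r F r.
  apply/seteqP; split=> w; last by case=> r _ [].
  move=> Aw; have [Xoo|[k k0 Xk]] := hX w; first by exists 0%N.
  by exists k => //; split=> //=; case: k k0 Xk.
have mF r : measurable (F r) by case: r => [//|r]; exact: mA.
have tF : trivIset setT F.
  by move=> i j _ _ [w [[/= + _] [/= + _]]] => -> /cI.
rewrite [in LHS]AF measure_semi_bigcup//; last exact: bigcup_measurable.
rewrite nneseries_recl//; congr (_ + _).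
(* Once both series are shifted to start at 0, every index is a successor, on which [c] computes to
   the finite value. *)
rewrite -[LHS]nneseries_addn// -[RHS]nneseries_addn//.
by apply: eq_eseriesr => i _; rewrite addn1.
Qed.

End total_probability.

Section renewal_events.
Context (d : measure_display) (T : measurableType d) (R : realType)
  (dt : nat -> T -> \bar R).
Hypothesis dt_pos : forall j w, pos_nat_or_infty (dt j w).
Hypothesis mdt : forall j, measurable_fun setT (dt j).

(** Waiting times are nonnegative, so arrival times are nondecreasing and the count is [m] exactly
    when [t] lies between arrivals [m] and [m.+1]. This reduces measurability to that of finite
    sums. *)
Lemma renewal_eqE (m t : nat) :
  [set w | renewal dt t w = m] =
  [set w | arrival dt m w <= t%:R%:E] `\` [set w | arrival dt m.+1 w <= t%:R%:E].
Proof.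
apply/seteqP; split=> w /=.
  move=> <-; have [le_t max_t] := renewal_max t (dt_pos^~ w); split=> //.
  by move=> /max_t; rewrite ltnn.
have [le_t max_t] := renewal_max t (dt_pos^~ w).
move=> [/max_t m_le gt_t]; apply/eqP; rewrite eqn_leq m_le andbT leqNgt.
(* If the count exceeded [m], arrival [m.+1] would be at most the last arrival before or at [t]. *)
apply/negP => m_lt; apply: gt_t; apply: le_trans le_t.
apply: (@lee_sum_nneg_ord _ (dt^~ w) xpredT) => // k _.
by case: (dt_pos k w) => [->|[n _ ->]]; rewrite ?leey// lee_fin.
Qed.

Lemma measurable_renewal_eq (m t : nat) :
  measurable [set w | renewal dt t w = m].
Proof.
have mle n : measurable [set w | arrival dt n w <= t%:R%:E].
  rewrite -[X in measurable X]setTI; apply: emeasurable_fun_infty_c => //.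
  exact: emeasurable_sum.
by rewrite renewal_eqE; exact: measurableD.
Qed.

End renewal_events.

(** Singletons are measurable, so the first event lies in [sigma_rv X] and the second is a generator
    of [sigma_process N]. *)
Lemma independent_of_processP (d : measure_display) (T : measurableType d)
    (R : realType) (P : probability T R) (X : T -> \bar R)
    (N : nat -> T -> nat) (x : \bar R) (m t : nat) :
  independent_of_process P X N ->
  P ([set w | X w = x] `&` [set w | N t w = m]) =
  P [set w | X w = x] * state_prob P N m t.
Proof.
apply.
  by exists [set x]; [exact: emeasurable_set1|rewrite setTI].
apply: sub_sigma_algebra; exists t => //.
by exists [set m] => //; rewrite setTI.
Qed.

Section stopped_values.
Context (d : measure_display) (T : measurableType d) (R : realType)
  (DT : T -> \bar R) (N : nat -> T -> nat).

Lemma stopped_infty (t : nat) (w : T) : DT w = +oo -> stopped DT N t w = N t w.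
Proof. by move=> DTw; rewrite /stopped DTw /Theta/= leey mul1n addn0. Qed.

Lemma Theta_subS (r t : nat) :
  Theta (r%:R%:E - t%:R%:E - 1 : \bar R) = (t < r)%N.
Proof. by rewrite /Theta lee_fin -addrA -opprD natr1 subr_ge0 ler_nat. Qed.

Lemma Theta_sub (r t : nat) :
  Theta (t%:R%:E - r%:R%:E : \bar R) = (r <= t)%N.
Proof. by rewrite /Theta lee_fin subr_ge0 ler_nat. Qed.

Lemma stopped_fin (r t : nat) (w : T) : DT w = r%:R%:E ->
  stopped DT N t w = N (minn t r) w.
Proof.
move=> DTw; rewrite /stopped DTw Theta_sub/= natrK.
(* [stopped] subtracts 1 before [t], [Theta_subS] the other way round. *)
rewrite addeAC Theta_subS.
by case: ltnP => _; rewrite ?mul1n ?addn0.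
Qed.

End stopped_values.

Theorem theorem4p11 (d : measure_display) (T : measurableType d) (R : realType)
    (P : probability T R)
    (dt : nat -> {RV P >-> \bar R}) (DT : {RV P >-> \bar R}) (QS : R)
    (hdt : recurrent_waiting_times P (fun j w => dt j w))
    (hDT : forall w, pos_nat_or_infty (DT w))
    (hind : independent_of_process P DT (renewal (fun j w => dt j w)))
    (hQS : (0 < QS <= 1)%R)
    (hsum : \sum_(1 <= r <oo) time_prob P DT r = QS%:E) :
  let N := renewal (fun j w => dt j w) in
  let M := stopped DT N in
  let psi := time_prob P DT in
  let Phi := state_prob P N in
  forall m t : nat,
    P [set w | M t w = m] =
    (1 - QS%:E) * Phi m t +
    \sum_(1 <= r <oo)
      psi r * (Phi m t * (Theta (r%:R%:E - t%:R%:E - 1 : \bar R))%:R%:E +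
               Phi m r * (Theta (t%:R%:E - r%:R%:E : \bar R))%:R%:E).
Proof.
move=> N M psi Phi m t; have [dt_pos _ _ _] := hdt.
have mDT x : measurable [set w | DT w = x].
  exact: (measurable_funPTI DT (emeasurable_set1 x)).
have mN s : measurable [set w | N s w = m].
  exact: measurable_renewal_eq.
(* Total probability applied to the whole space; the series equals the finite number [QS], hence can
   be cancelled. *)
have DToo : P [set w | DT w = +oo] = 1 - QS%:E.
  have := total_probability_pos_nat_or_infty P (A := setT) hDT.
  rewrite setIT probability_setT => ->//; last by move=> r _; rewrite setIT.
  under eq_eseriesr do rewrite setIT.
  by rewrite hsum addeK.
have Moo : [set w | DT w = +oo] `&` [set w | M t w = m] =
    [set w | DT w = +oo] `&` [set w | N t w = m].
  by apply/seteqP; split=> w [/= DTw]; rewrite /M stopped_infty.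
have Mr r : [set w | DT w = r%:R%:E] `&` [set w | M t w = m] =
    [set w | DT w = r%:R%:E] `&` [set w | N (minn t r) w = m].
  by apply/seteqP; split=> w [/= DTw]; rewrite /M (stopped_fin _ _ DTw).
(* On each piece [M] agrees with [N] at a deterministic time, which gives measurability. *)
rewrite (total_probability_pos_nat_or_infty P hDT); first last.
- by move=> r _; rewrite Mr; exact: measurableI.
- by rewrite Moo; exact: measurableI.
rewrite Moo independent_of_processP// DToo; congr (_ + _).
apply: eq_eseriesr => r _; rewrite Mr independent_of_processP//; congr (_ * _).
(* The conditions [t < r] and [r <= t] are complementary, so exactly one term survives, the one at
   time [minn t r]. *)
rewrite Theta_subS Theta_sub.
by case: ltnP => _; rewrite mule1 mule0 ?adde0 ?add0e.
Qed.
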